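(* Let $1\le p<n$ and $N\ge 1$ be integers, $C=[I_p\ \ 0]\in\mathbf{R}^{p\times n}$, $A_1,\dots,A_N\in\mathbf{R}^{n\times n}$, $x_0\in\mathbf{R}^n$, and let $\sigma:\{0,1,2,\dots\}\to\{1,\dots,N\}$ be an arbitrary switching signal. Consider the discrete-time switched linear system $$\Sigma_\sigma^d:\quad x(k+1)=A_{\sigma(k)}x(k),\quad x(0)=x_0,\qquad y(k)=Cx(k).$$ Suppose that there are (known) vectors $\underline{x}_0,\overline{x}_0\in\mathbf{R}^n$ and matrices $\underline{A}_i,\overline{A}_i\in\mathbf{R}^{n\times n}$ such that $0\le\underline{x}_0\le x_0\le\overline{x}_0$, $\underline{A}_i\le A_i\le\overline{A}_i$ and $\underline{A}_i\ge 0$ for $i=1,\dots,N$, and suppose that the state trajectory $x(k)$ of $\Sigma_\sigma^d$ is bounded. Let $\omega_0^\ell,\omega_0^u\in\mathbf{R}^{n-p}$ with $\omega_0^\ell\ge 0$, $\omega_0^u\ge 0$. Let $L\in\mathbf{R}_+^{(n-p)\times p}$ be a nonnegative matrix and, with the block partitions given in the context, put $$\underline{\hat A}_i:=\underline{A}_i^{22}-L\overline{A}_i^{12},\quad \overline{\hat A}_i:=\overline{A}_i^{22}-L\underline{A}_i^{12},$$ $$\underline{G}_i:=\underline{\hat A}_iL+\underline{A}_i^{21}-L\overline{A}_i^{11},\quad \overline{G}_i:=\overline{\hat A}_iL+\overline{A}_i^{21}-L\underline{A}_i^{11},$$ $$\hat C:=\begin{bmatrix}0\\ I_{n-p}\end{bmatrix},\quad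 \hat D:=\begin{bmatrix}I_p\\ L\end{bmatrix}.$$ Suppose that $L$ satisfies: (i) $\underline{\hat A}_i\ge 0$ for $i=1,\dots,N$; (ii) $\underline{G}_i\ge 0$ for $i=1,\dots,N$; (iii) there exists $\lambda\in\mathbf{R}^{n-p}$, $\lambda>0$, such that $(\overline{\hat A}_i-I_{n-p})^{\mathrm T}\lambda<0$ for all $i=1,\dots,N$; (iv) $\omega_0^\ell\le\underline{x}_0^2-L\overline{x}_0^1$ and $\overline{x}_0^2-L\underline{x}_0^1\le\omega_0^u$. Then $\omega_0^\ell\le\omega_0^u$, and the pair of $(n-p)$-dimensional switched systems $$\hat\Sigma_\sigma^{dr\ell}:\quad \omega^\ell(k+1)=\underline{\hat A}_{\sigma(k)}\omega^\ell(k)+\underline{G}_{\sigma(k)}y(k),\ \ \omega^\ell(0)=\omega_0^\ell,\qquad \hat x^\ell(k):=\hat C\omega^\ell(k)+\hat Dy(k),$$ $$\hat\Sigma_\sigma^{dru}:\quad \omega^u(k+1)=\overline{\hat A}_{\sigma(k)}\omega^u(k)+\overline{G}_{\sigma(k)}y(k),\ \ \omega^u(0)=\omega_0^u,\qquad \hat x^u(k):=\hat C\omega^u(k)+\hat Dy(k)$$ is an interval reduced-order switched positive observer for $\Sigma_\sigma^d$, in the sense that $\xi(k):=\hat x^u(k)-\hat x^\ell(k)$ is bounded and $$0\le\hat x^\ell(k)\le x(k)\le\hat x^u(k)\quad\text{for all } k=0,1,2,\dots.$$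
   Context: All inequalities between vectors or matrices are elementwise: $M\ge N$ means $m_{ij}\ge n_{ij}$ for all $i,j$; $M>0$ (resp. $M<0$) means all entries are positive (resp. negative). $\mathbf{R}_+^{r\times s}$ is the set of $r\times s$ matrices with nonnegative entries. Partitions: vectors in $\mathbf{R}^n$ are split as $\underline{x}_0=\begin{bmatrix}\underline{x}_0^1\\ \underline{x}_0^2\end{bmatrix}$, $\overline{x}_0=\begin{bmatrix}\overline{x}_0^1\\ \overline{x}_0^2\end{bmatrix}$ with $\underline{x}_0^1,\overline{x}_0^1\in\mathbf{R}^p$ and $\underline{x}_0^2,\overline{x}_0^2\in\mathbf{R}^{n-p}$; matrices are split conformally as $\underline{A}_i=\begin{bmatrix}\underline{A}_i^{11}&\underline{A}_i^{12}\\ \underline{A}_i^{21}&\underline{A}_i^{22}\end{bmatrix}$, $\overline{A}_i=\begin{bmatrix}\overline{A}_i^{11}&\overline{A}_i^{12}\\ \overline{A}_i^{21}&\overline{A}_i^{22}\end{bmatrix}$ with $\underline{A}_i^{11},\overline{A}_i^{11}\in\mathbf{R}^{p\times p}$. *)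

(* Defs.v *)
From mathcomp Require Import all_boot all_order all_algebra.
From mathcomp Require Import all_classical all_reals all_analysis.

Set Implicit Arguments.
Unset Strict Implicit.
Unset Printing Implicit Defensive.

Import Order.TTheory GRing.Theory Num.Theory.
Import numFieldNormedType.Exports.
Local Open Scope ring_scope.

(* The strict version is strict in every entry; it is not "<=e and <>". *)
Definition mxle (R : realType) (r s : nat) (M M' : 'M[R]_(r, s)) : Prop :=
  forall i j, M i j <= M' i j.

Definition mxlt (R : realType) (r s : nat) (M M' : 'M[R]_(r, s)) : Prop :=
  forall i j, M i j < M' i j.

Notation "M <=e M'" := (mxle M M') (at level 70, no associativity) : ring_scope.
Notation "M <e M'" := (mxlt M M') (at level 70, no associativity) : ring_scope.

Section Systems.
Context {R : realType} {N : nat}.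

Fixpoint switched_state (n : nat) (A : 'I_N -> 'M[R]_n) (sigma : nat -> 'I_N)
    (x0 : 'cV[R]_n) (k : nat) : 'cV[R]_n :=
  if k is k'.+1 then A (sigma k') *m switched_state A sigma x0 k' else x0.

Fixpoint driven_state (m p : nat) (F : 'I_N -> 'M[R]_m)
    (G : 'I_N -> 'M[R]_(m, p)) (sigma : nat -> 'I_N) (y : nat -> 'cV[R]_p)
    (w0 : 'cV[R]_m) (k : nat) : 'cV[R]_m :=
  if k is k'.+1
  then F (sigma k') *m driven_state F G sigma y w0 k' + G (sigma k') *m y k'
  else w0.

End Systems.

(* The state dimension is n = p + q, so that q = n - p; the blocks 11, 12, 21,
   22 of a matrix are its ulsubmx, ursubmx, dlsubmx, drsubmx, and the parts 1, 2
   of a vector are its usubmx, dsubmx. *)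
Section Observer.
Context {R : realType} {p q : nat}.
Implicit Types (Alo Aup : 'M[R]_(p + q)) (L : 'M[R]_(q, p)).

Definition output_mx : 'M[R]_(p, p + q) := row_mx 1%:M 0.

Definition Ahat_lo Alo Aup L : 'M[R]_q := drsubmx Alo - L *m ursubmx Aup.
Definition Ahat_up Alo Aup L : 'M[R]_q := drsubmx Aup - L *m ursubmx Alo.

Definition G_lo Alo Aup L : 'M[R]_(q, p) :=
  Ahat_lo Alo Aup L *m L + dlsubmx Alo - L *m ulsubmx Aup.
Definition G_up Alo Aup L : 'M[R]_(q, p) :=
  Ahat_up Alo Aup L *m L + dlsubmx Aup - L *m ulsubmx Alo.

Definition Chat : 'M[R]_(p + q, q) := col_mx 0 1%:M.
Definition Dhat L : 'M[R]_(p + q, p) := col_mx 1%:M L.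

Definition estimate L (w : nat -> 'cV[R]_q) (y : nat -> 'cV[R]_p) (k : nat)
  : 'cV[R]_(p + q) := Chat *m w k + Dhat L *m y k.

End Observer.

(* Boundedness is with respect to the library's norm on matrices, which is the
   maximum of the absolute values of the entries. *)
Definition interval_estimates (R : realType) (n : nat)
    (x xl xu : nat -> 'cV[R]_n) : Prop :=
  bounded_fun (fun k => xu k - xl k) /\
  forall k, [/\ 0 <=e xl k, xl k <=e x k & x k <=e xu k].

(* Main.v *)
(* In the coordinate [z = x^2 - L x^1] the plant reads [z(k+1) = F z(k) + G y(k)]
   with [F = A^22 - L A^12] and [G = F L + A^21 - L A^11], i.e. it obeys the
   observer equation with the true matrices in place of their bounds. Everything
   being nonnegative, monotonicity gives [0 <= w^l <= z <= w^u] along the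
   trajectories, which is the interval estimate.  For boundedness,
   [0 <= w^u - w^l <= w^u], and [lambda^T w] is a linear copositive Lyapunov
   function for the upper observer: condition (iii) makes it contract at a rate
   uniform in the mode, up to the bounded input [y]. *)

Require Import Defs.
From mathcomp Require Import all_boot all_order all_algebra.
From mathcomp Require Import all_classical all_reals all_analysis.
From mathcomp Require Import lra.

Import Order.TTheory GRing.Theory Num.Theory.
Import numFieldNormedType.Exports.
Local Open Scope ring_scope.

(** * Elementwise order on matrices and its link with norm boundedness *)

Section ElementwiseOrder.
Context {R : realType}.

Lemma mxle_refl {r s : nat} (M : 'M[R]_(r, s)) : M <=e M.
Proof. by move=> i j. Qed.

Lemma mxle_trans {r s : nat} {M1 M2 M3 : 'M[R]_(r, s)} :
  M1 <=e M2 -> M2 <=e M3 -> M1 <=e M3.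
Proof. by move=> le12 le23 i j; exact: le_trans (le12 i j) (le23 i j). Qed.

Lemma mxleD {r s : nat} {M1 M2 M1' M2' : 'M[R]_(r, s)} :
  M1 <=e M1' -> M2 <=e M2' -> M1 + M2 <=e M1' + M2'.
Proof. by move=> le1 le2 i j; rewrite !mxE lerD. Qed.

Lemma mxleB {r s : nat} {M1 M2 M1' M2' : 'M[R]_(r, s)} :
  M1 <=e M1' -> M2' <=e M2 -> M1 - M2 <=e M1' - M2'.
Proof. by move=> le1 le2 i j; rewrite !mxE lerB. Qed.

Lemma mxleM {r s t : nat} {M1 M1' : 'M[R]_(r, s)} {M2 M2' : 'M[R]_(s, t)} :
  0 <=e M1 -> 0 <=e M2 -> M1 <=e M1' -> M2 <=e M2' -> M1 *m M2 <=e M1' *m M2'.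
Proof.
move=> M1_ge0 M2_ge0 le1 le2 i j; rewrite !mxE ler_sum// => k _.
by rewrite ler_pM//; [have := M1_ge0 i k | have := M2_ge0 k j]; rewrite mxE.
Qed.

Lemma mxleM_l {r s t : nat} (M : 'M[R]_(r, s)) {M2 M2' : 'M[R]_(s, t)} :
  0 <=e M -> M2 <=e M2' -> M *m M2 <=e M *m M2'.
Proof.
move=> M_ge0 le2 i j; rewrite !mxE ler_sum// => k _.
by rewrite ler_wpM2l//; have := M_ge0 i k; rewrite mxE.
Qed.

Lemma mxleM_r {r s t : nat} {M1 M1' : 'M[R]_(r, s)} (M : 'M[R]_(s, t)) :
  0 <=e M -> M1 <=e M1' -> M1 *m M <=e M1' *m M.
Proof.
move=> M_ge0 le1 i j; rewrite !mxE ler_sum// => k _.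
by rewrite ler_wpM2r//; have := M_ge0 k j; rewrite mxE.
Qed.

Lemma mulmx_ge0 {r s t : nat} {M1 : 'M[R]_(r, s)} {M2 : 'M[R]_(s, t)} :
  0 <=e M1 -> 0 <=e M2 -> 0 <=e M1 *m M2.
Proof. by move=> M1_ge0 M2_ge0; rewrite -(mulmx0 t M1); exact: mxleM_l. Qed.

Lemma mxleZ {r s : nat} (a : R) {M M' : 'M[R]_(r, s)} :
  0 <= a -> M <=e M' -> a *: M <=e a *: M'.
Proof. by move=> a_ge0 le i j; rewrite !mxE ler_wpM2l. Qed.

Lemma scalemx_ge0 {r s : nat} (a : R) {M : 'M[R]_(r, s)} :
  0 <= a -> 0 <=e M -> 0 <=e a *: M.
Proof.
by move=> a_ge0 M_ge0 i j; have := M_ge0 i j; rewrite !mxE; exact: mulr_ge0.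
Qed.

Lemma mxle_sum {r s : nat} {I : finType} (M : I -> 'M[R]_(r, s)) (i : I) :
  (forall i', 0 <=e M i') -> M i <=e \sum_i' M i'.
Proof.
move=> M_ge0 a b; rewrite summxE (bigD1 i)//= lerDl sumr_ge0// => i' _.
by have := M_ge0 i' a b; rewrite mxE.
Qed.

Lemma bounded_mxP {r s : nat} {T : Type} (f : T -> 'M[R]_(r, s)) :
  bounded_fun f <-> exists B, forall k i j, `|f k i j| <= B.
Proof.
split=> [[B [_ f_le]]|[B f_le]].
  (* [bounded_fun] supplies the norm bound only for constants strictly above [B]. *)
  exists (B + 1) => k i j.
  have : `|f k| <= B + 1 by apply: f_le => //; rewrite ltrDl.
  rewrite [X in X <= _]/Num.Def.normr /= mx_normrE; apply: le_trans.
  exact: (le_bigmax _ (fun ij => `|f k ij.1 ij.2|) (i, j)).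
(* [B] may be negative when there are no entries, whereas the norm is a maximum seeded with 0; the
   absolute value keeps [M] nonnegative. *)
exists `|B|; split=> [|M ltBM k _]; first exact: num_real.
rewrite /= [X in X <= _]/Num.Def.normr /= mx_normrE; apply/bigmax_leP; split.
  exact: le_trans (ltW ltBM).
move=> [i j] _; apply: le_trans (f_le k i j) _.
exact: le_trans (ler_norm B) (ltW ltBM).
Qed.

Lemma bounded_fun_mx {r s : nat} {T : Type} (f : T -> 'M[R]_(r, s)) B :
  (forall k, 0 <=e f k) -> (forall k, f k <=e B) -> bounded_fun f.
Proof.
move=> f_ge0 f_le; apply/bounded_mxP.
exists (\big[Num.max/0]_ij B ij.1 ij.2) => k i j.
have := f_ge0 k i j; rewrite mxE => fk_ge0.
rewrite ger0_norm//; apply: le_trans (f_le k i j) _.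
exact: (le_bigmax _ (fun ij => B ij.1 ij.2) (i, j)).
Qed.

Lemma switched_state_ge0 {N n : nat} (A : 'I_N -> 'M[R]_n) sigma x0 k :
  (forall i, 0 <=e A i) -> 0 <=e x0 -> 0 <=e switched_state A sigma x0 k.
Proof. by move=> A_ge0 x0_ge0; elim: k => //= k; exact: mulmx_ge0. Qed.

End ElementwiseOrder.

(** * Comparison and boundedness of positive driven systems *)

Section DrivenSystems.
Context {R : realType} {N m p : nat}.

(** The two claims share one induction: a matrix product is monotone in both factors only when the
    smaller factors are nonnegative, so the sign of the lower trajectory feeds the comparison. *)
Lemma driven_state_homo (F F' : 'I_N -> 'M[R]_m) (G G' : 'I_N -> 'M[R]_(m, p))
    (sigma : nat -> 'I_N) (y : nat -> 'cV[R]_p) (w w' : 'cV[R]_m) :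
    (forall i, 0 <=e F i) -> (forall i, F i <=e F' i) ->
    (forall i, G i <=e G' i) -> (forall k, 0 <=e y k) ->
    (forall i, 0 <=e G i) -> 0 <=e w -> w <=e w' ->
  forall k, 0 <=e driven_state F G sigma y w k /\
            driven_state F G sigma y w k <=e driven_state F' G' sigma y w' k.
Proof.
move=> F_ge0 leF leG y_ge0 G_ge0 w_ge0 lew; elim=> [|k [IH0 IH]] //=; split.
  by rewrite -[0]addr0; apply: mxleD; exact: mulmx_ge0.
by apply: mxleD; [exact: mxleM | exact: mxleM_r].
Qed.

(* The strict inequality of condition (iii) becomes a uniform contraction rate
   because there are finitely many modes and coordinates. *)
Lemma contraction_rate (F : 'I_N -> 'M[R]_m) (lambda : 'cV[R]_m) :
    0 <e lambda -> (forall i, (F i - 1%:M)^T *m lambda <e 0) ->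
  exists d : R, [/\ 0 < d, d <= 1 &
    forall i, lambda^T *m F i <=e (1 - d) *: lambda^T].
Proof.
move=> lambda_gt0 F_lt.
have l_gt0 j : 0 < lambda j 0 by have := lambda_gt0 j 0; rewrite mxE.
(* Relative decrease of coordinate [ij.2] of [lambda^T] under mode [ij.1]; transposing the
   hypothesis shows that it is positive. *)
pose gap ij := (lambda^T - lambda^T *m F ij.1) 0 ij.2 / lambda ij.2 0.
have gap_gt0 ij : 0 < gap ij.
  rewrite divr_gt0// -oppr_lt0; have := F_lt ij.1 ij.2 0.
  rewrite -[lambda in X in X -> _]trmxK -trmx_mul mulmxBr mulmx1.
  by rewrite !mxE opprB.
(* Seeding the minimum with 1 gives [d <= 1], so that the factor [1 - d] is nonnegative. *)
exists (\big[Num.min/1]_ij gap ij); split.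
- by apply/bigmin_gtP.
- exact: bigmin_le_id.
move=> i i0 j; rewrite [i0]ord1.
have : (\big[Num.min/1]_ij gap ij) <= gap (i, j) by exact: bigmin_le.
rewrite ler_pdivlMr// !mxE /=; set S := \sum_k _; lra.
Qed.

Lemma driven_state_ubound (F : 'I_N -> 'M[R]_m) (G : 'I_N -> 'M[R]_(m, p))
    (sigma : nat -> 'I_N) (y : nat -> 'cV[R]_p) (w : 'cV[R]_m)
    (b : 'cV[R]_p) (lambda : 'cV[R]_m) :
    0 <e lambda -> (forall i, (F i - 1%:M)^T *m lambda <e 0) ->
    (forall i, 0 <=e F i) -> (forall i, 0 <=e G i) ->
    (forall k, 0 <=e y k) -> (forall k, y k <=e b) -> 0 <=e w ->
  exists B, forall k, driven_state F G sigma y w k <=e B.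
Proof.
move=> lambda_gt0 F_lt F_ge0 G_ge0 y_ge0 y_le w_ge0.
have [d [d_gt0 d_le1 rateF]] := contraction_rate F lambda lambda_gt0 F_lt.
have l_gt0 j : 0 < lambda j 0 by have := lambda_gt0 j 0; rewrite mxE.
have lT_ge0 : 0 <=e lambda^T by move=> i j; rewrite [i]ord1 !mxE ltW.
have wk_ge0 k : 0 <=e driven_state F G sigma y w k.
  by have [] := driven_state_homo F F G G sigma y w w F_ge0 (fun=> mxle_refl _)
    (fun=> mxle_refl _) y_ge0 G_ge0 w_ge0 (mxle_refl w) k.
have b_ge0 : 0 <=e b by exact: mxle_trans (y_ge0 0) (y_le 0).
(* Largest contribution of the input in mode [i]; the sum over all modes bounds it independently of
   the switching. *)
pose c i := lambda^T *m (G i *m b).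
have c_ge0 i : 0 <=e c i by do 2?apply: mulmx_ge0.
have sumc_ge0 : 0 <=e \sum_i c i.
  move=> i j; rewrite summxE mxE sumr_ge0// => i' _.
  by have := c_ge0 i' i j; rewrite mxE.
(* The factor [d^-1] makes [d *: V] dominate [\sum_i c i]. One step then gives at most
   [(1 - d) *: V + d *: V], which is [V] again. *)
pose V := lambda^T *m w + d^-1 *: \sum_i c i.
have V_inv k : lambda^T *m driven_state F G sigma y w k <=e V.
  elim: k => [|k IH] /=.
    rewrite -[X in X <=e _]addr0; apply: mxleD; first exact: mxle_refl.
    apply: scalemx_ge0 sumc_ge0.
    by rewrite invr_ge0 ltW.
  rewrite mulmxDr mulmxA.
  have -> : V = (1 - d) *: V + d *: V by rewrite -scalerDl subrK scale1r.
  apply: mxleD.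
    apply: mxle_trans (mxleM_r _ (wk_ge0 k) (rateF (sigma k))) _.
    by rewrite -scalemxAl; apply: mxleZ => //; rewrite subr_ge0.
  apply: (mxle_trans (M2 := \sum_i c i)).
    apply: mxle_trans (mxle_sum c (sigma k) c_ge0).
    by do 2![apply: mxleM_l => //].
  rewrite /V scalerDr scalerA divff ?gt_eqF// scale1r.
  rewrite -[X in X <=e _]add0r; apply: mxleD; last exact: mxle_refl.
  by apply: scalemx_ge0; [exact: ltW | exact: mulmx_ge0].
(* All terms of [lambda^T *m w] are nonnegative, so each one alone is at most [V]. *)
exists (\col_j (V 0 0 / lambda j 0)) => k j j0; rewrite [j0]ord1 mxE.
rewrite ler_pdivlMr//; apply: le_trans (V_inv k 0 0).
rewrite mxE (bigD1 j)//= mxE mulrC lerDl sumr_ge0// => j' _.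
rewrite mxE mulr_ge0//; first exact: ltW.
by have := wk_ge0 k j' 0; rewrite mxE.
Qed.

End DrivenSystems.

(** * Monotonicity of the observer matrices and the reduced plant equation *)

Section ObserverMatrices.
Context {R : realType} {p q : nat}.
Context (L : 'M[R]_(q, p)) (L_ge0 : 0 <=e L).
Implicit Types A B : 'M[R]_(p + q).

(* The upper matrices are the lower ones with the two bounds exchanged, so these
   lemmas serve both observers. *)
Lemma Ahat_lo_homo A A' B B' :
  A <=e A' -> B' <=e B -> Ahat_lo A B L <=e Ahat_lo A' B' L.
Proof.
move=> leA leB; apply: mxleB; first by move=> i j; rewrite !mxE; exact: leA.
by apply: mxleM_l => // i j; rewrite !mxE; exact: leB.
Qed.

Lemma G_lo_homo A A' B B' :
  A <=e A' -> B' <=e B -> G_lo A B L <=e G_lo A' B' L.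
Proof.
move=> leA leB; apply: mxleB; last first.
  by apply: mxleM_l => // i j; rewrite !mxE; exact: leB.
apply: mxleD; last by move=> i j; rewrite !mxE; exact: leA.
by apply: mxleM_r => //; exact: Ahat_lo_homo.
Qed.

Lemma output_mxE (x : 'cV[R]_(p + q)) : output_mx *m x = usubmx x.
Proof. by rewrite -{1}[x]vsubmxK mul_row_col mul1mx mul0mx addr0. Qed.

Lemma estimateE w y k :
  estimate L w y k = col_mx (y k) (w k + L *m y k) :> 'cV[R]_(p + q).
Proof.
by rewrite /estimate !mul_col_mx !mul1mx mul0mx add_col_mx add0r.
Qed.

Lemma reduced_state_driven {N : nat} (A : 'I_N -> 'M[R]_(p + q)) sigma x0 k :
  let x := switched_state A sigma x0 in
  dsubmx (x k) - L *m usubmx (x k) =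
  driven_state (fun i => Ahat_lo (A i) (A i) L) (fun i => G_lo (A i) (A i) L)
    sigma (fun k => output_mx *m x k) (dsubmx x0 - L *m usubmx x0) k.
Proof.
elim: k => //= k <-; rewrite output_mxE.
move: (A _) (switched_state A sigma x0 k) => {x0}A x.
have -> : A *m x = block_mx (ulsubmx A) (ursubmx A) (dlsubmx A) (drsubmx A) *m
                   col_mx (usubmx x) (dsubmx x) by rewrite submxK vsubmxK.
rewrite mul_block_col col_mxKd col_mxKu /G_lo.
(* Kept folded as [H], this matrix lets the two terms [H *m L *m usubmx x], one from the state and
   one from the input gain, cancel before it is expanded. *)
move HE: (Ahat_lo A A L) => H.
rewrite mulmxBr !mulmxDl mulNmx mulmxA !addrA subrK -HE /Ahat_lo mulmxBl.
rewrite mulmxDr opprD !mulmxA [X in _ + X = _]addrC addrA; congr (_ - _).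
by rewrite [X in X - _ = _]addrC addrAC.
Qed.

End ObserverMatrices.

(** * The interval observer *)

Theorem theorem2 (R : realType) (p q N : nat)
    (p_gt0 : (0 < p)%N) (q_gt0 : (0 < q)%N) (N_gt0 : (0 < N)%N)
    (A Alo Aup : 'I_N -> 'M[R]_(p + q))
    (x0 x0lo x0up : 'cV[R]_(p + q)) (sigma : nat -> 'I_N)
    (x0lo_ge0 : 0 <=e x0lo) (x0lo_le : x0lo <=e x0) (x0up_ge : x0 <=e x0up)
    (Alo_le : forall i, Alo i <=e A i) (Aup_ge : forall i, A i <=e Aup i)
    (Alo_ge0 : forall i, 0 <=e Alo i)
    (x_bounded : bounded_fun (switched_state A sigma x0))
    (wl0 wu0 : 'cV[R]_q) (wl0_ge0 : 0 <=e wl0) (wu0_ge0 : 0 <=e wu0)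
    (L : 'M[R]_(q, p)) (L_ge0 : 0 <=e L)
    (cond_i : forall i, 0 <=e Ahat_lo (Alo i) (Aup i) L)
    (cond_ii : forall i, 0 <=e G_lo (Alo i) (Aup i) L)
    (cond_iii : exists lambda : 'cV[R]_q, 0 <e lambda /\
       forall i, (Ahat_up (Alo i) (Aup i) L - 1%:M)^T *m lambda <e 0)
    (cond_iv_lo : wl0 <=e dsubmx x0lo - L *m usubmx x0up)
    (cond_iv_up : dsubmx x0up - L *m usubmx x0lo <=e wu0) :
  wl0 <=e wu0 /\
  let x := switched_state A sigma x0 in
  let y := fun k => output_mx *m x k in
  let wl := driven_state (fun i => Ahat_lo (Alo i) (Aup i) L)
                         (fun i => G_lo (Alo i) (Aup i) L) sigma y wl0 in
  let wu := driven_state (fun i => Ahat_up (Alo i) (Aup i) L)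
                         (fun i => G_up (Alo i) (Aup i) L) sigma y wu0 in
  interval_estimates x (estimate L wl y) (estimate L wu y).
Proof.
pose x := switched_state A sigma x0.
have A_ge0 i : 0 <=e A i := mxle_trans (Alo_ge0 i) (Alo_le i).
have x_ge0 k : 0 <=e x k.
  exact: switched_state_ge0 (mxle_trans x0lo_ge0 x0lo_le).
pose y k : 'cV[R]_p := output_mx *m x k.
have y_ge0 k : 0 <=e y k.
  by move=> i j; rewrite /y output_mxE !mxE; have := x_ge0 k (lshift q i) j;
    rewrite mxE.
pose z0 := dsubmx x0 - L *m usubmx x0.
have wl0_le : wl0 <=e z0.
  apply: mxle_trans cond_iv_lo _; apply: mxleB.
    by move=> i j; rewrite !mxE; exact: x0lo_le.
  by apply: mxleM_l => // i j; rewrite !mxE; exact: x0up_ge.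
have z0_le : z0 <=e wu0.
  apply: mxle_trans cond_iv_up; apply: mxleB.
    by move=> i j; rewrite !mxE; exact: x0up_ge.
  by apply: mxleM_l => // i j; rewrite !mxE; exact: x0lo_le.
split; first exact: mxle_trans z0_le.
(* With [A i] as both of its bounds, the exact reduced plant is sandwiched between the two
   observers. *)
pose F i := Ahat_lo (A i) (A i) L.
pose G i := G_lo (A i) (A i) L.
have F_ge i : Ahat_lo (Alo i) (Aup i) L <=e F i by exact: Ahat_lo_homo.
have F_le i : F i <=e Ahat_up (Alo i) (Aup i) L by exact: Ahat_lo_homo.
have G_ge i : G_lo (Alo i) (Aup i) L <=e G i by exact: G_lo_homo.
have G_le i : G i <=e G_up (Alo i) (Aup i) L by exact: G_lo_homo.
have F_ge0 i : 0 <=e F i := mxle_trans (cond_i i) (F_ge i).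
have G_ge0 i : 0 <=e G i := mxle_trans (cond_ii i) (G_ge i).
have z0_ge0 : 0 <=e z0 := mxle_trans wl0_ge0 wl0_le.
move=> /=; rewrite -/x -/y.
set wl := driven_state _ _ _ _ wl0; set wu := driven_state _ _ _ _ wu0.
pose z := driven_state F G sigma y z0.
(* The plant state has the form of an estimate with [z] as observer state, so comparing estimates
   reduces to comparing [wl], [z] and [wu]. *)
have xE k : x k = col_mx (y k) (z k + L *m y k).
  by rewrite /z /y -reduced_state_driven output_mxE subrK vsubmxK.
have wl_z k : 0 <=e wl k /\ wl k <=e z k by exact: driven_state_homo.
have z_wu k : 0 <=e z k /\ z k <=e wu k by exact: driven_state_homo.
have Ly_ge0 k : 0 <=e L *m y k by exact: mulmx_ge0.
have col_le k (u v : 'cV[R]_q) :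
    u <=e v -> col_mx (y k) (u + L *m y k) <=e col_mx (y k) (v + L *m y k).
  move=> le_uv i j; rewrite !mxE; case: splitP => // i' _.
  exact: mxleD le_uv (mxle_refl _) i' j.
split; last first.
  move=> k; rewrite !estimateE; split.
  (* The intermediate vector is the estimate given by the zero observer state. *)
  - apply: (mxle_trans (M2 := col_mx (y k) (0 + L *m y k))); last first.
      by apply: col_le; have [] := wl_z k.
    by move=> i j; rewrite !mxE add0r; case: splitP => i' _;
      [have := y_ge0 k i' j | have := Ly_ge0 k i' j]; rewrite !mxE.
  - by rewrite xE; apply: col_le; have [] := wl_z k.
  - by rewrite xE; apply: col_le; have [] := z_wu k.
have [b y_le] : exists b, forall k, y k <=e b.
  have /bounded_mxP[B x_le] := x_bounded.
  exists (const_mx B) => k i j; rewrite /y output_mxE !mxE.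
  exact: le_trans (ler_norm _) (x_le k _ _).
have [lambda [lambda_gt0 Fup_lt]] := cond_iii.
have [W wu_le] := driven_state_ubound _ _ sigma y wu0 b lambda lambda_gt0 Fup_lt
  (fun i => mxle_trans (F_ge0 i) (F_le i))
  (fun i => mxle_trans (G_ge0 i) (G_le i)) y_ge0 y_le wu0_ge0.
(* The output terms cancel, so only [wu k - wl k] is left to bound; it lies between 0 and [wu k]. *)
have xiE k : estimate L wu y k - estimate L wl y k = col_mx 0 (wu k - wl k).
  by rewrite !estimateE opp_col_mx add_col_mx subrr opprD addrACA subrr addr0.
apply: (bounded_fun_mx (fun k => _) (col_mx 0 W)) => k i j; rewrite xiE !mxE;
  case: splitP => i' _; rewrite ?mxE//.
  have [_ le_wz] := wl_z k; have [_ le_zw] := z_wu k.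
  by rewrite subr_ge0; exact: mxle_trans le_wz le_zw i' j.
have [wl_ge0 _] := wl_z k; have := wl_ge0 i' j; rewrite mxE => wl_ge0'.
by apply: le_trans (wu_le k i' j); rewrite lerBlDr lerDl.
Qed.
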